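(* For any positive integer $N$ there exists a set $A\subseteq\mathbb{N}$ with $|A|=N$ such that for an arbitrary $B\subseteq A$ with $|B|\ge|A|/2$ one has $$\mathsf{E}^{+}_3(B),\ \mathsf{E}^{\times}_3(B)\gg |A|^{13/4}\quad\text{and}\quad D^{+}(B),\ D^{\times}(B)\gtrsim |A|^{1/4}.$$
   Context: $\mathsf{E}^{+}_3(X)$ is the number of $(x_1,x_1',x_2,x_2',x_3,x_3')\in X^6$ with $x_1-x_1'=x_2-x_2'=x_3-x_3'$; $\mathsf{E}^{\times}_3(X)$ is the number of such tuples with $x_1/x_1'=x_2/x_2'=x_3/x_3'$. $D^{+}(X)$ is the infimum of all $D>0$ such that for every finite $G\subset\mathbb{R}$ and real $\tau\ge1$, $|\{ s\in X-G : |X\cap (G+s)|\ge\tau\}| \le D|X||G|^2/\tau^3$; $D^{\times}(X)$ is the infimum of all $D>0$ such that for every finite $G\subset\mathbb{R}$ and real $\tau\ge1$, $|\{ s\in X/G : |X\cap sG|\ge\tau\}| \le D|X||G|^2/\tau^3$, where $X/G=\{x/g:x\in X,g\in G,g\ne0\}$. $a\gg b$ means $a\ge c\,b$ for an absolute constant $c>0$; $a\gtrsim b$ means $a\ge c\, b\,(\log|A|)^{-C}$ for absolute constants $c,C>0$. *)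

(* Defs.v *)
From HB Require Import structures.
From mathcomp Require Import all_boot all_order all_algebra finmap.
From mathcomp Require Import all_classical all_reals all_analysis.

Set Implicit Arguments.
Unset Strict Implicit.
Unset Printing Implicit Defensive.

Import Order.TTheory GRing.Theory Num.Theory.

Local Open Scope classical_set_scope.
Local Open Scope fset_scope.
Local Open Scope ring_scope.

Definition E3_add (R : realType) (X : {fset R}) : nat :=
  #|[set t : (X * X) * (X * X) * (X * X) |
     let: ((x1, x1'), (x2, x2'), (x3, x3')) := t in
     (val x1 - val x1' == val x2 - val x2')
     && (val x2 - val x2' == val x3 - val x3')]%SET|.

(* Tuples with a zero denominator are excluded: inversion sends 0 to 0. *)
Definition E3_mul (R : realType) (X : {fset R}) : nat :=
  #|[set t : (X * X) * (X * X) * (X * X) |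
     let: ((x1, x1'), (x2, x2'), (x3, x3')) := t in
     [&& val x1' != 0, val x2' != 0, val x3' != 0,
         val x1 / val x1' == val x2 / val x2'
       & val x2 / val x2' == val x3 / val x3']]%SET|.

Definition popular_differences (R : realType) (X G : {fset R}) (tau : R)
    : {fset R} :=
  [fset s in [fset x - g | x in X, g in G]
     | tau <= #|` X `&` [fset g + s | g in G]|%:R].

Definition popular_quotients (R : realType) (X G : {fset R}) (tau : R)
    : {fset R} :=
  [fset s in [fset x / g | x in X, g in G `\ 0]
     | tau <= #|` X `&` [fset s * g | g in G]|%:R].

(* The sets whose infima define D_add and D_mul are bounded below by 0 and
   nonempty (#|` X| + 1 belongs to both), so the real infimum is the true one. *)
Definition D_add (R : realType) (X : {fset R}) : R :=
  inf [set D : R | 0 < D /\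
    forall (G : {fset R}) (tau : R), 1 <= tau ->
      #|` popular_differences X G tau|%:R
        <= D * #|` X|%:R * #|` G|%:R ^+ 2 / tau ^+ 3]%classic.

Definition D_mul (R : realType) (X : {fset R}) : R :=
  inf [set D : R | 0 < D /\
    forall (G : {fset R}) (tau : R), 1 <= tau ->
      #|` popular_quotients X G tau|%:R
        <= D * #|` X|%:R * #|` G|%:R ^+ 2 / tau ^+ 3]%classic.

Definition fset_of_nats (R : realType) (A : {fset nat}) : {fset R} :=
  [fset n%:R | n in A].

(* The logarithmic factor in a lower bound up to powers of log n.  The maximum
   with 1 only matters for n = 1, where (ln n)^(-C) is undefined, and for
   n = 2, where it is absorbed by the multiplicative constant. *)
Definition log_factor (R : realType) (n : nat) : R := Num.max 1 (ln n%:R).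

(* Main.v *)
Require Import Defs.
From HB Require Import structures.
From mathcomp Require Import all_boot all_order all_algebra finmap.
From mathcomp Require Import all_classical all_reals all_analysis.
From mathcomp Require Import zify ring lra.

(** A is made of numbers 2^j (2i + 1) with j < M ~ N^(1/4) and i < L ~ N^(3/4):
    each row (j fixed) is an arithmetic progression, each column (i fixed) a
    geometric one.  Let B contain half of A.  The pairs of B lying in a common
    row have few differences, those lying in a common column have few ratios,
    so the power mean inequality bounds both energies from below.  For D^+, a
    row containing at least |B|/M elements of B lies in each of L translates of
    a progression of length 2L; for D^x, the whole of B lies in each of M
    dilates of a grid of size 2LM. *)

Set Implicit Arguments.
Unset Strict Implicit.
Unset Printing Implicit Defensive.

Import Order.TTheory GRing.Theory Num.Theory.

Local Open Scope fset_scope.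
Local Open Scope ring_scope.

(** * Power means and coincidences of a map *)

Lemma sqr_sum_le (K : finType) (n : K -> nat) :
  ((\sum_k n k) ^ 2 <= #|K| * \sum_k n k ^ 2)%N.
Proof.
(* Once doubled, both sides are sums over pairs, compared termwise by 2ab <= a^2 + b^2. *)
rewrite -(leq_pmul2l (m := 2)) //.
have -> : (2 * (\sum_k n k) ^ 2 = \sum_x \sum_y 2 * (n x * n y))%N.
  rewrite expnSr expn1 big_distrl big_distrr; apply: eq_bigr => x _ /=.
  by rewrite big_distrr big_distrr.
have -> : (2 * (#|K| * \sum_k n k ^ 2) = \sum_x \sum_y (n x ^ 2 + n y ^ 2))%N.
  under [RHS]eq_bigr do rewrite big_split sum_nat_const /=.
  rewrite big_split sum_nat_const /=.
  by rewrite -[X in (X + _)%N]big_distrr /= addnn mul2n.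
by apply: leq_sum => x _; apply: leq_sum => y _; exact: nat_Cauchy.
Qed.

(** With power sums s1, s2, s3, Cauchy-Schwarz gives s1^2 <= |K| s2 and s2^2 <= s1 s3. Squaring the
    first and inserting the second gives s1^4 <= |K|^2 s1 s3, and one s1 cancels. *)
Lemma cube_sum_le (K : finType) (n : K -> nat) :
  ((\sum_k n k) ^ 3 <= #|K| ^ 2 * \sum_k n k ^ 3)%N.
Proof.
set s1 := (\sum_k n k)%N; set s3 := (\sum_k n k ^ 3)%N.
pose s2 := (\sum_k n k ^ 2)%N.
have h12 : (s1 ^ 2 <= #|K| * s2)%N by exact: sqr_sum_le.
have h23 : (s2 ^ 2 <= s1 * s3)%N.
  (* Symmetrized over pairs, the termwise inequality is ab times 2ab <= a^2 + b^2. *)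
  rewrite -(leq_pmul2l (m := 2)) //.
  have -> : (2 * s2 ^ 2 = \sum_x \sum_y 2 * (n x ^ 2 * n y ^ 2))%N.
    rewrite expnSr expn1 /s2 big_distrl big_distrr; apply: eq_bigr => x _ /=.
    by rewrite big_distrr big_distrr.
  have -> : (2 * (s1 * s3) = \sum_x \sum_y (n x * n y ^ 3 + n y * n x ^ 3))%N.
    under [RHS]eq_bigr do rewrite big_split /=.
    rewrite big_split /= [X in (_ = _ + X)%N]exchange_big /= addnn -mul2n.
    by rewrite /s1 /s3 big_distrl; congr (2 * _)%N; apply: eq_bigr => x _ /=;
      rewrite big_distrr.
  apply: leq_sum => x _; apply: leq_sum => y _.
  have := nat_Cauchy (n x) (n y); set a := n x; set b := n y => h.
  have -> : (2 * (a ^ 2 * b ^ 2) = (a * b) * (2 * (a * b)))%N by ring.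
  have -> : (a * b ^ 3 + b * a ^ 3 = (a * b) * (a ^ 2 + b ^ 2))%N by ring.
  by rewrite leq_mul2l h orbT.
have [->|s1_gt0] := posnP s1; first by rewrite exp0n.
rewrite -(leq_pmul2l s1_gt0) -expnS.
have -> : (s1 ^ 4 = (s1 ^ 2) ^ 2)%N by rewrite -expnM.
apply: (leq_trans (_ : _ <= (#|K| * s2) ^ 2)%N); first by rewrite leq_exp2r.
by rewrite expnMn mulnCA leq_mul2l h23 orbT.
Qed.

(** A fibre of size [n k] supplies [n k ^ 2] coinciding pairs. Taking [f] to be one grid coordinate
    shows that many pairs share a row or a column. *)
Lemma card_eq_pairs (T K : finType) (f : T -> K) :
  (#|T| ^ 2 <= #|K| * #|[set p : T * T | f p.1 == f p.2]%SET|)%N.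
Proof.
pose n k := #|[pred x | f x == k]|.
have -> : #|T| = (\sum_k n k)%N.
  rewrite -sum1_card (partition_big f predT) //=; apply: eq_bigr => k _.
  by rewrite sum1_card.
apply: leq_trans (sqr_sum_le n) _; rewrite leq_mul2l; apply/orP; right.
rewrite -sum1_card (partition_big (fun p => f p.1) predT) //=.
apply: leq_sum => k _; rewrite sum1_card -mulnn -cardX subset_leq_card //.
apply/fintype.subsetP => -[x y]; rewrite !inE /= => /andP[fx fy].
by rewrite unfold_in /= inE /= (eqP fx) (eqP fy) eqxx.
Qed.

(** The cubic analogue, on fibres inside [P]. For the energies, [T] consists of pairs and [f] is a
    label that determines the difference or the ratio of a pair in [P]. *)
Lemma card_eq_triples (T K : finType) (P : {set T}) (f : T -> K) :
  (#|P| ^ 3 <= #|K| ^ 2 * #|[set t : T * T * T |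
     [&& t.1.1 \in P, t.1.2 \in P, t.2 \in P, f t.1.1 == f t.1.2
       & f t.1.2 == f t.2]]%SET|)%N.
Proof.
pose n k := #|[pred x in P | f x == k]|.
have -> : #|P| = (\sum_k n k)%N.
  rewrite -sum1_card (partition_big f predT) //=; apply: eq_bigr => k _.
  by rewrite sum1_card.
apply: leq_trans (cube_sum_le n) _; rewrite leq_mul2l; apply/orP; right.
rewrite -sum1_card (partition_big (fun t => f t.2) predT) //=.
apply: leq_sum => k _; rewrite sum1_card expnSr expnSr expn1 -!cardX subset_leq_card //.
apply/fintype.subsetP => -[[x y] z]; rewrite !inE /=.
move=> /andP[/andP[/andP[xP fx] /andP[yP fy]] /andP[zP fz]].
by rewrite unfold_in /= inE /= xP yP zP (eqP fx) (eqP fy) (eqP fz) eqxx.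
Qed.

(** * The numbers 2^j (2i + 1) *)

Definition dyadic (i j : nat) : nat := ((2 * i).+1 * 2 ^ j)%N.

Lemma dyadic_gt0 i j : (0 < dyadic i j)%N.
Proof. by rewrite muln_gt0 expn_gt0. Qed.

(** The exponent [j] is the 2-adic valuation; the odd part then gives [i]. *)
Lemma dyadic_inj i j i' j' : dyadic i j = dyadic i' j' -> i = i' /\ j = j'.
Proof.
have logE k l : logn 2 (dyadic k l) = l.
  rewrite lognM ?expn_gt0 // pfactorK // logn_coprime //.
  by rewrite coprime2n /= mul2n odd_double.
move=> e; have ej : j = j' by rewrite -(logE i j) e logE.
split=> //; move/eqP: e; rewrite ej /dyadic eqn_pmul2r ?expn_gt0 //; lia.
Qed.

(** * Third energies of a subset of the grid *)

Section Grid.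
Variables (R : realType) (X : {fset R}) (L M : nat).
Variables (i : X -> 'I_L) (j : X -> 'I_M).
Hypothesis valE : forall x : X, val x = (dyadic (i x) (j x))%:R.

(** At least |X|^2 / M pairs lie in a common row. The row and the difference of indices determine
    the difference of such a pair, so 2LM labels suffice. *)
Lemma E3_add_grid : (#|` X| ^ 6 <= 4 * L ^ 2 * M ^ 5 * E3_add X)%N.
Proof.
pose P := [set p : X * X | j p.1 == j p.2]%SET.
have lab_lt (p : X * X) : (i p.1 + (L - i p.2) < 2 * L)%N.
  have := ltn_ord (i p.1); lia.
(* L is added so that the difference of indices does not truncate. *)
pose f (p : X * X) : 'I_M * 'I_(2 * L) := (j p.1, Ordinal (lab_lt p)).
have h1 : (#|` X| ^ 2 <= M * #|P|)%N.
  by rewrite cardfE -{1}(card_ord M); exact: card_eq_pairs.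
have h2 := card_eq_triples P f.
rewrite card_prod !card_ord in h2.
have h3 : (#|P| ^ 3 <= (M * (2 * L)) ^ 2 * E3_add X)%N.
  apply: leq_trans h2 _; rewrite leq_mul2l; apply/orP; right.
  apply: subset_leq_card; apply/fintype.subsetP => -[[p q] r].
  have diffE (u v : X * X) : u \in P -> v \in P -> f u == f v ->
      val u.1 - val u.2 == val v.1 - val v.2.
    rewrite !inE !valE => /eqP eu /eqP ev; rewrite -eu -ev.
    move=> /eqP[/(congr1 val) /= -> ei].
    have e : (i u.1 + i v.2)%N = (i v.1 + i u.2)%N.
      by have := ltn_ord (i u.2); have := ltn_ord (i v.2); lia.
    have {}e : ((i u.1)%:R + (i v.2)%:R = (i v.1)%:R + (i u.2)%:R :> R).
      by rewrite -!natrD e.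
    apply/eqP; rewrite /dyadic !natrM -!natr1 !natrM.
    by rewrite -!mulrBl; congr (_ * _); lra.
  rewrite !inE /= => /and5P[pP qP rP pq qr].
  move: p q r pP qP rP pq qr => [p1 p2] [q1 q2] [r1 r2] pP qP rP pq qr.
  by rewrite (diffE (p1, p2) (q1, q2)) ?inE //= (diffE (q1, q2) (r1, r2)) ?inE.
have -> : (#|` X| ^ 6 = (#|` X| ^ 2) ^ 3)%N by rewrite -expnM.
apply: (leq_trans (_ : _ <= (M * #|P|) ^ 3)%N); first by rewrite leq_exp2r.
rewrite expnMn.
have -> : (4 * L ^ 2 * M ^ 5 * E3_add X = M ^ 3 * ((M * (2 * L)) ^ 2 * E3_add X))%N.
  by ring.
by rewrite leq_mul2l h3 orbT.
Qed.

(** At least |X|^2 / L pairs share [i]. Their ratio is a power of 2 independent of [i], so the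
    shifted difference of exponents alone serves as label, with only 2M values. *)
Lemma E3_mul_grid : (#|` X| ^ 6 <= 4 * M ^ 2 * L ^ 3 * E3_mul X)%N.
Proof.
pose P := [set p : X * X | i p.1 == i p.2]%SET.
have lab_lt (p : X * X) : (j p.1 + (M - j p.2) < 2 * M)%N.
  have := ltn_ord (j p.1); lia.
pose f (p : X * X) := Ordinal (lab_lt p).
have h1 : (#|` X| ^ 2 <= L * #|P|)%N.
  by rewrite cardfE -{1}(card_ord L); exact: card_eq_pairs.
have h2 := card_eq_triples P f.
rewrite !card_ord in h2.
have val_neq0 (x : X) : val x != 0 by rewrite valE pnatr_eq0 -lt0n dyadic_gt0.
have h3 : (#|P| ^ 3 <= (2 * M) ^ 2 * E3_mul X)%N.
  apply: leq_trans h2 _; rewrite leq_mul2l; apply/orP; right.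
  apply: subset_leq_card; apply/fintype.subsetP => -[[p q] r].
  have divE (u v : X * X) : u \in P -> v \in P -> f u == f v ->
      val u.1 / val u.2 == val v.1 / val v.2.
    rewrite !inE eqr_div // !valE => /eqP eu /eqP ev; rewrite -eu -ev.
    move=> /eqP[ej].
    have e : (j u.1 + j v.2)%N = (j v.1 + j u.2)%N.
      by have := ltn_ord (j u.2); have := ltn_ord (j v.2); lia.
    (* After cross-multiplication both sides are the same two odd parts times the same power of
       2. *)
    rewrite -!natrM /dyadic mulnACA -expnD e [X in _ == X%:R]mulnACA -expnD.
    by rewrite [X in (X * _)%N%:R == _]mulnC.
  rewrite !inE /= => /and5P[pP qP rP pq qr].
  move: p q r pP qP rP pq qr => [p1 p2] [q1 q2] [r1 r2] pP qP rP pq qr.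
  rewrite !val_neq0 /=.
  by rewrite (divE (p1, p2) (q1, q2)) ?inE //= (divE (q1, q2) (r1, r2)) ?inE.
have -> : (#|` X| ^ 6 = (#|` X| ^ 2) ^ 3)%N by rewrite -expnM.
apply: (leq_trans (_ : _ <= (L * #|P|) ^ 3)%N); first by rewrite leq_exp2r.
rewrite expnMn.
have -> : (4 * M ^ 2 * L ^ 3 * E3_mul X = L ^ 3 * ((2 * M) ^ 2 * E3_mul X))%N.
  by ring.
by rewrite leq_mul2l h3 orbT.
Qed.

End Grid.

(** * Lower bounds for [D_add] and [D_mul] from a single test set *)

Lemma card_imfset_le (K : choiceType) (U : finType) (f : U -> K) (A : {set U}) :
  (#|` [fset f x | x in A]%fset| <= #|A|)%N.
Proof. by apply: leq_trans (leq_imfset_card _ _ _) _; rewrite cardE. Qed.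

Lemma card_imfset_inj (K : choiceType) (U : finType) (f : U -> K) (A : {set U}) :
  injective f -> #|` [fset f x | x in A]%fset| = #|A|.
Proof. by move=> f_inj; rewrite card_imfset // cardE. Qed.

Section Popular.
Variables (R : realType) (X : {fset R}).

(** Every admissible [D], tested at this [G] and [tau], is at least [b]. The two general bounds on
    [F] ensure that an admissible [D] exists. Keeping [F] abstract serves differences and quotients
    alike. *)
Lemma popular_le_inf (F : {fset R} -> R -> {fset R}) (S G : {fset R}) (tau b : R) :
  (forall G tau, (#|` F G tau| <= #|` X| * #|` G|)%N) ->
  (forall G tau s, s \in F G tau -> tau <= #|` X|%:R /\ tau <= #|` G|%:R) ->
  1 <= tau -> S `<=` F G tau -> (0 < #|` X|)%N -> (0 < #|` G|)%N ->
  b * #|` X|%:R * #|` G|%:R ^+ 2 <= #|` S|%:R * tau ^+ 3 ->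
  b <= inf [set D : R | 0 < D /\
    forall (G : {fset R}) (tau : R), 1 <= tau ->
      #|` F G tau|%:R <= D * #|` X|%:R * #|` G|%:R ^+ 2 / tau ^+ 3]%classic.
Proof.
move=> cardF tauF tau_ge1 SF X_gt0 G_gt0 hb; apply: lb_le_inf.
  (* Without a witness the infimum would be the junk value inf set0 = 0. *)
  exists (#|` X|%:R ^+ 2); split; first by rewrite exprn_gt0 ?ltr0n.
  move=> H t t_ge1; have t_gt0 : 0 < t by lra.
  have [->|[s sF]] := fset_0Vmem (F H t).
    by rewrite cardfs0 divr_ge0 // ?mulr_ge0 ?exprn_ge0 // ltW.
  have [tX tH] := tauF _ _ _ sF.
  rewrite ler_pdivlMr ?exprn_gt0 //.
  (* The regrouping matches three bounds: the popular set by |X| |H|, two factors [t] by |X|, and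
     the third by |H|. *)
  have -> : #|` X|%:R ^+ 2 * #|` X|%:R * #|` H|%:R ^+ 2 =
      (#|` X| * #|` H|)%:R * (#|` X|%:R ^+ 2 * #|` H|%:R) :> R.
    by rewrite natrM; ring.
  rewrite exprSr; apply: ler_pM; rewrite ?mulr_ge0 ?exprn_ge0 ?(ltW t_gt0) //.
    by rewrite ler_nat.
  by apply: ler_pM; rewrite ?exprn_ge0 ?(ltW t_gt0) // lerXn2r ?nnegrE ?ler0n // ltW.
move=> D [D_gt0 /(_ G tau tau_ge1) hD].
have t_gt0 : 0 < tau by lra.
rewrite ler_pdivlMr ?exprn_gt0 // in hD.
have cS : #|` S|%:R <= #|` F G tau|%:R :> R by rewrite ler_nat fsubset_leq_card.
have {}hb : b * (#|` X|%:R * #|` G|%:R ^+ 2) <= D * (#|` X|%:R * #|` G|%:R ^+ 2).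
  rewrite (mulrA b) (mulrA D); apply: (le_trans hb); apply: le_trans hD.
  by rewrite ler_wpM2r ?exprn_ge0 ?(ltW t_gt0).
by rewrite ler_pM2r // in hb; rewrite mulr_gt0 ?exprn_gt0 ?ltr0n.
Qed.

Lemma popular_tau_le (f : R -> R) (G : {fset R}) (tau : R) :
  tau <= #|` X `&` [fset f g | g in G]|%:R ->
  tau <= #|` X|%:R /\ tau <= #|` G|%:R.
Proof.
move=> h; split; apply: (le_trans h); rewrite ler_nat.
  by rewrite fsubset_leq_card // fsubsetIl.
by apply: leq_trans (fsubset_leq_card (fsubsetIr _ _)) _; exact: leq_imfset_card.
Qed.

Lemma card_imfset2_le (f : R -> R -> R) (G : {fset R}) :
  (#|` [fset f x g | x in X, g in G]%fset| <= #|` X| * #|` G|)%N.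
Proof.
pose A := [set: X * G]%SET.
apply: (leq_trans (_ : _ <= #|` [fset f (val p.1) (val p.2) | p in A]%fset|)%N).
  apply: fsubset_leq_card; apply/fsubsetP => _ /imfset2P[x xX [g gG ->]].
  by apply/imfsetP; exists ([` xX], [` gG]); rewrite ?inE.
by apply: leq_trans (card_imfset_le _ _) _; rewrite cardsT card_prod !cardfE.
Qed.

Lemma D_add_ge (S G : {fset R}) (tau b : R) :
  1 <= tau -> S `<=` popular_differences X G tau ->
  (0 < #|` X|)%N -> (0 < #|` G|)%N ->
  b * #|` X|%:R * #|` G|%:R ^+ 2 <= #|` S|%:R * tau ^+ 3 -> b <= D_add X.
Proof.
apply: popular_le_inf => [H t|H t s].
  by apply: leq_trans (card_imfset2_le _ H); apply: fsubset_leq_card; exact: fset_sub.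
by rewrite !inE => /andP[_]; exact: popular_tau_le.
Qed.

Lemma D_mul_ge (S G : {fset R}) (tau b : R) :
  1 <= tau -> S `<=` popular_quotients X G tau ->
  (0 < #|` X|)%N -> (0 < #|` G|)%N ->
  b * #|` X|%:R * #|` G|%:R ^+ 2 <= #|` S|%:R * tau ^+ 3 -> b <= D_mul X.
Proof.
apply: popular_le_inf => [H t|H t s].
  apply: leq_trans (leq_trans (card_imfset2_le _ (H `\ 0)) _).
    by apply: fsubset_leq_card; exact: fset_sub.
  by rewrite leq_mul2l fsubset_leq_card ?orbT // fsubD1set.
by rewrite !inE => /andP[_]; exact: popular_tau_le.
Qed.

End Popular.

(** * The constants [D_add] and [D_mul] of a subset of the grid *)

Section GridD.
Variables (R : realType) (X : {fset R}) (L M : nat).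
Variables (i : X -> 'I_L) (j : X -> 'I_M).
Hypothesis valE : forall x : X, val x = (dyadic (i x) (j x))%:R.

(** Row [k] has common difference 2^(k+1), so its part in [X] lies in each translate of the
    progression [G] by -2^(k+1) m with m < L. This makes all L shifts popular at level [n]; the
    hypothesis uses 2L as an upper bound for |G|. *)
Lemma D_add_grid (k : 'I_M) (b : R) (n := #|[set x | j x == k]%SET|) :
  (0 < n)%N -> 0 <= b ->
  b * #|` X|%:R * (2 * L%:R) ^+ 2 <= L%:R * n%:R ^+ 3 -> b <= D_add X.
Proof.
move=> n_gt0 b_ge0 hb.
have [x0] := card_gt0P n_gt0; rewrite inE => /eqP jx0.
pose G := [fset ((dyadic l k)%:R : R) | l : 'I_(2 * L) in [set: 'I_(2 * L)]%SET].
pose S := [fset (- (2 ^ k.+1 * m)%:R : R) | m : 'I_L in [set: 'I_L]%SET].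
have shift (x : X) (m : 'I_L) : j x = k ->
    exists2 g, g \in G & val x = g + - (2 ^ k.+1 * m)%:R.
  move=> jx; have lt : (i x + m < 2 * L)%N.
    by have := ltn_ord (i x); have := ltn_ord m; lia.
  exists (dyadic (i x + m) k)%:R.
    by apply/imfsetP; exists (Ordinal lt); rewrite ?inE.
  rewrite valE jx; apply/eqP; rewrite eq_sym subr_eq -natrD eqr_nat; apply/eqP.
  by rewrite /dyadic expnS; ring.
have G_gt0 : (0 < #|` G|)%N.
  rewrite cardfs_gt0; apply/fset0Pn.
  by have [g gG _] := shift x0 (i x0) jx0; exists g.
have cS : #|` S| = L.
  rewrite card_imfset_inj ?cardsT ?card_ord // => m m' /oppr_inj/eqP.
  by rewrite eqr_nat eqn_pmul2l ?expn_gt0 // => /eqP/val_inj.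
have cG : (#|` G| <= 2 * L)%N.
  by apply: leq_trans (card_imfset_le _ _) _; rewrite cardsT card_ord.
have X_gt0 : (0 < #|` X|)%N.
  by rewrite cardfE; apply/card_gt0P; exists x0.
apply: (@D_add_ge _ _ S G n%:R) => //.
- by rewrite ler1n.
- apply/fsubsetP => s /imfsetP[m _ ->]; rewrite !inE; apply/andP; split.
    have [g gG xE] := shift x0 m jx0.
    apply/imfset2P; exists (val x0); first exact: valP.
    by exists g => //=; rewrite xE addrC addKr.
  rewrite ler_nat /n -(card_imfset_inj _ (@val_inj _ _ X)); apply: fsubset_leq_card.
  apply/fsubsetP => _ /imfsetP[x + ->]; rewrite /= inE => /eqP jx.
  rewrite inE (valP x) /=; have [g gG xE] := shift x m jx.
  by apply/imfsetP; exists g.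
rewrite cS; apply: le_trans hb; rewrite ler_wpM2l ?mulr_ge0 //.
by rewrite lerXn2r ?nnegrE ?mulr_ge0 // -natrM ler_nat.
Qed.

(** Doubling the range of exponents gives a grid [G] whose dilates by 2^(-m), m < M, all contain
    [X]. These M dilations are thus popular at the level [tau] = |X|. *)
Lemma D_mul_grid (b : R) :
  (0 < #|` X|)%N -> 0 <= b ->
  b * (2 * (L%:R * M%:R)) ^+ 2 <= M%:R * #|` X|%:R ^+ 2 -> b <= D_mul X.
Proof.
move=> X_gt0 b_ge0 hb.
have [x0 _] : exists x0 : X, true.
  by move: X_gt0; rewrite cardfs_gt0 => /fset0Pn[x xX]; exists [` xX].
pose G := [fset ((dyadic p.1 p.2)%:R : R)
  | p : 'I_L * 'I_(2 * M) in [set: 'I_L * 'I_(2 * M)]%SET].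
pose S := [fset ((2 ^ m)%:R^-1 : R) | m : 'I_M in [set: 'I_M]%SET].
have pow_neq0 m : (2 ^ m)%:R != 0 :> R by rewrite pnatr_eq0 -lt0n expn_gt0.
have scale (x : X) (m : 'I_M) : exists2 g, g \in G & val x = (2 ^ m)%:R^-1 * g.
  have lt : (j x + m < 2 * M)%N.
    by have := ltn_ord (j x); have := ltn_ord m; lia.
  exists (dyadic (i x) (j x + m))%:R.
    by apply/imfsetP; exists (i x, Ordinal lt); rewrite ?inE.
  by rewrite valE /dyadic expnD mulnA [in RHS]natrM [RHS]mulrC mulfK.
have G_neq0 g : g \in G -> g != 0.
  by move=> /imfsetP[p _ ->]; rewrite pnatr_eq0 -lt0n dyadic_gt0.
have G_gt0 : (0 < #|` G|)%N.
  rewrite cardfs_gt0; apply/fset0Pn.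
  by have [g gG _] := scale x0 (j x0); exists g.
have cS : #|` S| = M.
  rewrite card_imfset_inj ?cardsT ?card_ord // => m m' /invr_inj/eqP.
  by rewrite eqr_nat eqn_exp2l // => /eqP/val_inj.
have cG : (#|` G| <= L * (2 * M))%N.
  by apply: leq_trans (card_imfset_le _ _) _; rewrite cardsT card_prod !card_ord.
apply: (@D_mul_ge _ _ S G #|` X|%:R) => //.
- by rewrite ler1n.
- apply/fsubsetP => s /imfsetP[m _ ->]; rewrite !inE; apply/andP; split.
    have [g gG xE] := scale x0 m.
    apply/imfset2P; exists (val x0); first exact: valP.
    by exists g; rewrite /= ?inE ?G_neq0 // xE mulfK ?G_neq0.
  rewrite ler_nat; apply: fsubset_leq_card.
  apply/fsubsetP => x xX; rewrite inE xX /=.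
  have [g gG xE] := scale [` xX] m.
  by apply/imfsetP; exists g.
(* Since [tau] is |X|, one factor |X| cancels, leaving the square in [hb]. *)
rewrite cS mulrAC [_ ^+ 3]exprSr mulrA ler_wpM2r //; apply: le_trans hb.
rewrite ler_wpM2l // lerXn2r ?nnegrE ?mulr_ge0 //.
by rewrite -!natrM ler_nat mulnCA.
Qed.

End GridD.

(** * Numerical inequalities, with q = N^(1/4) and m, l, x standing for M, L, |X| *)

Lemma le_half_sixth_power (R : realFieldType) (q x k E : R) :
  0 < q -> q ^+ 4 / 2 <= x -> 0 <= E -> x ^+ 6 <= k * q ^+ 11 * E -> 0 <= k ->
  q ^+ 13 <= 64 * k * E.
Proof.
move=> q_gt0 hx E_ge0 h k_ge0; have q4 : 0 < q ^+ 4 by rewrite exprn_gt0.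
have h6 : (q ^+ 4 / 2) ^+ 6 <= x ^+ 6 by rewrite lerXn2r ?nnegrE //; lra.
have q11 : 0 < q ^+ 11 by rewrite exprn_gt0.
rewrite -(ler_pM2l q11); have := le_trans h6 h.
have -> : (q ^+ 4 / 2) ^+ 6 = q ^+ 11 * q ^+ 13 / 64 by field.
by rewrite ler_pdivrMr //; lra.
Qed.

Lemma E3_add_numerics (R : realFieldType) (q m l x E : R) :
  1 <= m -> m <= q -> 0 <= l -> l * m <= 2 * q ^+ 4 -> q ^+ 4 / 2 <= x ->
  0 <= E -> x ^+ 6 <= 4 * l ^+ 2 * m ^+ 5 * E ->
  4096^-1 * q ^+ 13 <= E.
Proof.
move=> m_ge1 m_le l_ge0 lm_le x_ge E_ge0 h.
have q_ge1 : 1 <= q by lra.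
have lm_ge0 : 0 <= l * m by rewrite mulr_ge0 //; lra.
have q4_gt0 : 0 < q ^+ 4 by rewrite exprn_gt0 //; lra.
suff : q ^+ 13 <= 64 * 16 * E by move=> ?; lra.
apply: (@le_half_sixth_power _ q x) => //; try lra.
apply: (le_trans h); rewrite ler_wpM2r //.
(* Pairing each [l] with an [m] leaves [m ^+ 3], for which the upper bound [m <= q] suffices. *)
have -> : 4 * l ^+ 2 * m ^+ 5 = 4 * (l * m) ^+ 2 * m ^+ 3 by ring.
have -> : 16 * q ^+ 11 = 4 * (2 * q ^+ 4) ^+ 2 * q ^+ 3 by ring.
apply: ler_pM; rewrite ?mulr_ge0 ?exprn_ge0 //; try lra.
- by rewrite ler_wpM2l // lerXn2r ?nnegrE //; lra.
- by rewrite lerXn2r ?nnegrE //; lra.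
Qed.

Lemma E3_mul_numerics (R : realFieldType) (q m l x E : R) :
  1 <= m -> m <= q -> q <= 2 * m -> 0 <= l -> l * m <= 2 * q ^+ 4 ->
  q ^+ 4 / 2 <= x -> 0 <= E -> x ^+ 6 <= 4 * m ^+ 2 * l ^+ 3 * E ->
  4096^-1 * q ^+ 13 <= E.
Proof.
move=> m_ge1 m_le q_le l_ge0 lm_le x_ge E_ge0 h.
have q_ge1 : 1 <= q by lra.
have lm_ge0 : 0 <= l * m by rewrite mulr_ge0 //; lra.
have q4_gt0 : 0 < q ^+ 4 by rewrite exprn_gt0 //; lra.
suff : q ^+ 13 <= 64 * 64 * E by move=> ?; lra.
apply: (@le_half_sixth_power _ q x) => //; try lra.
have q_gt0 : 0 < q by lra.
(* Here [l] has the larger exponent, so a factor [m] is missing; it is supplied by multiplying by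
   [q <= 2 * m]. *)
rewrite -(ler_pM2l q_gt0).
apply: (@le_trans _ _ (2 * m * x ^+ 6)).
  by rewrite ler_wpM2r ?exprn_ge0 //; lra.
have -> : q * (64 * q ^+ 11 * E) = 8 * (2 * q ^+ 4) ^+ 3 * E by ring.
apply: (@le_trans _ _ (2 * m * (4 * m ^+ 2 * l ^+ 3 * E))).
  by rewrite ler_wpM2l //; lra.
have -> : 2 * m * (4 * m ^+ 2 * l ^+ 3 * E) = 8 * (l * m) ^+ 3 * E by ring.
by rewrite ler_wpM2r // ler_wpM2l // lerXn2r ?nnegrE //; lra.
Qed.

Lemma D_add_numerics (R : realFieldType) (q m l x k : R) :
  1 <= m -> m <= q -> 0 <= l -> l * m <= 2 * q ^+ 4 -> q ^+ 4 / 2 <= x ->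
  0 <= k -> x <= m * k ->
  128^-1 * q * x * (2 * l) ^+ 2 <= l * k ^+ 3.
Proof.
move=> m_ge1 m_le l_ge0 lm_le x_ge k_ge0 xk.
have q_ge1 : 1 <= q by lra.
have lm_ge0 : 0 <= l * m by rewrite mulr_ge0 //; lra.
have q4_gt0 : 0 < q ^+ 4 by rewrite exprn_gt0 //; lra.
have m_gt0 : 0 < m by lra.
have x_ge0 : 0 <= x by lra.
(* The factor [m ^+ 3] turns [k ^+ 3] into [(m * k) ^+ 3], which is at least [x ^+ 3]. *)
rewrite -(ler_pM2r (exprn_gt0 3 m_gt0)).
apply: (@le_trans _ _ (l * x ^+ 3)); last first.
  by rewrite -mulrA ler_wpM2l // -exprMn lerXn2r ?nnegrE ?mulr_ge0 //; lra.
have -> : 128^-1 * q * x * (2 * l) ^+ 2 * m ^+ 3 =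
    l * x * (32^-1 * q * (l * m) * m ^+ 2) by field.
have -> : l * x ^+ 3 = l * x * x ^+ 2 by ring.
rewrite ler_wpM2l ?mulr_ge0 //.
apply: (@le_trans _ _ ((q ^+ 4 / 2) ^+ 2)); last first.
  by rewrite lerXn2r ?nnegrE //; lra.
apply: (@le_trans _ _ (32^-1 * q * (2 * q ^+ 4) * q ^+ 2)).
  apply: ler_pM; rewrite ?mulr_ge0 ?exprn_ge0 //; try lra.
  - by rewrite ler_wpM2l //; lra.
  - by rewrite lerXn2r ?nnegrE //; lra.
have -> : 32^-1 * q * (2 * q ^+ 4) * q ^+ 2 = q ^+ 7 / 16 by field.
have -> : (q ^+ 4 / 2) ^+ 2 = q ^+ 7 * q / 4 by field.
have : q ^+ 7 <= q ^+ 7 * q by rewrite ler_peMr ?exprn_ge0 //; lra.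
have : 0 <= q ^+ 7 by rewrite exprn_ge0 //; lra.
lra.
Qed.

Lemma D_mul_numerics (R : realFieldType) (q m l x : R) :
  1 <= m -> m <= q -> q <= 2 * m -> 0 <= l -> l * m <= 2 * q ^+ 4 ->
  q ^+ 4 / 2 <= x -> 128^-1 * q * (2 * (l * m)) ^+ 2 <= m * x ^+ 2.
Proof.
move=> m_ge1 m_le q_le l_ge0 lm_le x_ge.
have q_ge1 : 1 <= q by lra.
have lm_ge0 : 0 <= l * m by rewrite mulr_ge0 //; lra.
have q4_gt0 : 0 < q ^+ 4 by rewrite exprn_gt0 //; lra.
apply: (@le_trans _ _ (128^-1 * q * (2 * (2 * q ^+ 4)) ^+ 2)).
  by rewrite ler_wpM2l ?mulr_ge0 // ?lerXn2r ?nnegrE ?mulr_ge0 //; lra.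
(* The constant 1/128 is exactly what makes this an equality. *)
have -> : 128^-1 * q * (2 * (2 * q ^+ 4)) ^+ 2 = q / 2 * (q ^+ 4 / 2) ^+ 2 by field.
apply: ler_pM; rewrite ?exprn_ge0 //; try lra.
by rewrite lerXn2r ?nnegrE //; lra.
Qed.

(** * Pigeonhole for rows, choice of parameters and conclusion *)

Lemma exists_large_fiber (T : finType) (M : nat) (f : T -> 'I_M) :
  (0 < M)%N -> exists k, (#|T| <= M * #|[set x | f x == k]%SET|)%N.
Proof.
move=> M_gt0; apply/fintype.existsP; apply: contraT.
rewrite negb_exists => /fintype.forallP h.
have : (\sum_(k < M) M * #|[set x | f x == k]%SET| < \sum_(k < M) #|T|)%N.
  apply: (@leq_trans (\sum_(k < M) (M * #|[set x | f x == k]%SET|).+1)).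
    under [X in (_ < X)%N]eq_bigr do rewrite -addn1.
    by rewrite big_split sum_nat_const /= card_ord muln1 -addn1 leq_add2l.
  by apply: leq_sum => k _; rewrite ltnNge h.
rewrite -big_distrr sum_nat_const card_ord /= ltn_pmul2l //.
rewrite -sum1_card (partition_big f predT) //= ltnNge leq_sum // => k _.
by rewrite sum1_card cardsE.
Qed.

Lemma card_fset_of_nats (R : realType) (B : {fset nat}) :
  #|` fset_of_nats R B| = #|` B|.
Proof. by rewrite card_imfset //; exact: mulrIn (oner_neq0 R). Qed.

Theorem theorem22 (R : realType) :
  exists c c' C : R, [/\ 0 < c, 0 < c', 0 < C &
    forall N : nat, (0 < N)%N ->
    exists A : {fset nat},
      [/\ forall a : nat, a \in A -> (0 < a)%N,
          #|` A| = N &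
          forall B : {fset nat}, B `<=` A -> (#|` A|%:R / 2 <= #|` B|%:R :> R) ->
            [/\ c * #|` A|%:R `^ (13 / 4) <= (E3_add (fset_of_nats R B))%:R,
                c * #|` A|%:R `^ (13 / 4) <= (E3_mul (fset_of_nats R B))%:R,
                c' * #|` A|%:R `^ (1 / 4) * log_factor R #|` A| `^ (- C)
                  <= D_add (fset_of_nats R B) &
                c' * #|` A|%:R `^ (1 / 4) * log_factor R #|` A| `^ (- C)
                  <= D_mul (fset_of_nats R B)]]].
Proof.
(* 4096 = 64 * 64 comes from [E3_mul_numerics] and 128 from [D_mul_numerics]. *)
exists 4096^-1, 128^-1, 1; split; [by rewrite invr_gt0 ltr0n..|exact: ltr01|].
move=> N N_gt0.
pose q : R := N%:R `^ (1 / 4).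
have q4 : q ^+ 4 = N%:R.
  by rewrite -powR_mulrn ?powR_ge0 // -powRrM mul1r mulVf ?powRr1 ?ler0n.
have q13 : N%:R `^ (13 / 4) = q ^+ 13.
  by rewrite -powR_mulrn ?powR_ge0 // -powRrM mul1r mulrC.
have q_ge1 : 1 <= q.
  by rewrite -(@ler_pXn2r _ 4) ?nnegrE ?powR_ge0 ?ler01 // q4 expr1n ler1n.
(* Rounding [L] up makes room for N points, while LM <= N + M <= 2N. *)
pose M := Num.truncn q; pose L := (N %/ M).+1.
have /andP[M_le M_gt] : M%:R <= q < M.+1%:R by apply: truncn_itv; lra.
have M_gt0 : (0 < M)%N by rewrite -ltnS -(ltr_nat R); lra.
have M_ge1 : 1 <= M%:R :> R by rewrite ler1n.
have q_le : q <= 2 * M%:R by move: M_gt; rewrite -natr1; lra.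
have M_leN : (M <= N)%N.
  rewrite -(ler_nat R) -q4; apply: (le_trans M_le).
  by rewrite exprS ler_peMr ?exprn_ege1 //; lra.
have LM_le : L%:R * M%:R <= 2 * q ^+ 4.
  by rewrite q4 -!natrM ler_nat /L mulSn mul2n -addnn leq_add // leq_trunc_div.
(* Euclidean division numbers exactly N grid points: the quotient is the index [i] of the odd part,
   the remainder the exponent [j]. *)
pose row n := (n %/ M)%N; pose col n := (n %% M)%N.
have row_lt (n : 'I_N) : (row n < L)%N.
  by rewrite ltnS leq_div2r // ltnW.
have col_lt (n : 'I_N) : (col n < M)%N by rewrite ltn_pmod.
pose A := [fset dyadic (row n) (col n) | n : 'I_N in [set: 'I_N]%SET].
have cA : #|` A| = N.
  rewrite card_imfset_inj ?cardsT ?card_ord // => n n' /dyadic_inj[er ec].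
  by apply: val_inj; rewrite /= (divn_eq n M) (divn_eq n' M) -/(row n) er -/(col n) ec.
exists A; split=> // [a /imfsetP[n _ ->]|B BA]; first exact: dyadic_gt0.
rewrite !cA q13 -/q -q4 -(card_fset_of_nats R) => cB.
set X := fset_of_nats R B in cB |- *.
have code (x : X) : exists n : 'I_N, val x = (dyadic (row n) (col n))%:R.
  have /imfsetP[b bB ->] := valP x.
  by have /imfsetP[n _ ->] := fsubsetP BA _ bB; exists n.
have [h hE] := fin_all_exists code.
pose i x := Ordinal (row_lt (h x)); pose j x := Ordinal (col_lt (h x)).
have {}hE x : val x = (dyadic (i x) (j x))%:R by exact: hE.
have X_gt0 : (0 < #|` X|)%N.
  rewrite -(ltr_nat R); apply: lt_le_trans cB.
  by rewrite divr_gt0 // exprn_gt0 //; lra.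
(* [log_factor] is at least 1, so its inverse only lowers the bound. *)
have log_le : 128^-1 * q * log_factor R N `^ (- 1) <= 128^-1 * q.
  rewrite ler_piMr ?mulr_ge0 //; try lra.
  by rewrite powR_inv1 ?invf_le1 ?le_max ?lt_max ?lexx ?ltr01 // ler01.
have b_ge0 : 0 <= 128^-1 * q by lra.
split.
- apply: (E3_add_numerics M_ge1 M_le (l := L%:R) (x := #|` X|%:R)) => //.
  by rewrite -!natrX -!natrM ler_nat; exact: E3_add_grid hE.
- apply: (E3_mul_numerics M_ge1 M_le q_le (l := L%:R) (x := #|` X|%:R)) => //.
  by rewrite -!natrX -!natrM ler_nat; exact: E3_mul_grid hE.
- apply: (le_trans log_le); have [k hk] := exists_large_fiber j M_gt0.
  apply: (D_add_grid hE (k := k)) => //.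
    move: hk X_gt0; rewrite cardfE; case: #|[set x | _]%SET| => //.
    by rewrite muln0; case: #|_|.
  apply: D_add_numerics LM_le cB _ _ => //.
  by rewrite -natrM ler_nat cardfE.
- by apply: (le_trans log_le); apply: (D_mul_grid hE) => //; apply: D_mul_numerics.
Qed.
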